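(* Let $M\ge 2$, let $S=\{i_1,\ldots,i_M\}\subset\mathbb{R}$ with $i_1<\cdots<i_M$, and let $\underline p=(p_1,\ldots,p_M)$ satisfy $\min_{j}p_j>0$ and $\sum_{j=1}^M p_j=1$. Regard $\underline p$ as a probability mass function over $S$, with expected value $e_0=\sum_{j=1}^M i_jp_j$, and let $l$ be the index with $i_{l-1}<e_0\le i_l$. Let $a\in(0,1)$ and let $\tau$ be a random time with $\mathbb{P}(\tau=k)=(1-a)a^k$ for $k=0,1,2,\ldots$. Let $\mathcal F(\underline p,\cdot)$ be as defined in the context. Then there is a DMRW $X$ with state space $S$ (see context), with parameter vector $\underline q$ and one step transition matrix $P$, independent of $\tau$, such that for every $j\in\{1,\ldots,M\}$ $$\frac{e_0-i_{l-1}}{i_l-i_{l-1}}\,\mathbb{P}(X_\tau=i_j\mid X_0=i_l)+\frac{i_l-e_0}{i_l-i_{l-1}}\,\mathbb{P}(X_\tau=i_j\mid X_0=i_{l-1})=p_j$$ if and only if $$\max_{k\in\{1,\ldots,M\}}\Big(\frac1a-1\Big)\mathcal F(\underline p,k)\le 1 .$$ The components of the vector $\underline q$ are given by $q_j=\left(\frac1a-1\right)\mathcal F(\underline p,j)$ for $j\in\{2,\ldots,M-1\}$ and $q_1=q_M=0$.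
   Context: DMRW (discrete time Markov martingale random walk on the finite state space $S=\{i_1<\cdots<i_M\}$): a martingale that is a time homogeneous discrete time Markov process for which there is a row vector $\underline q=(q_1,\ldots,q_M)\in\{0\}\times[0,1]^{M-2}\times\{0\}$ such that the one step transition probabilities $P_{j,k}=\mathbb{P}(X_{t+1}=i_k\mid X_t=i_j)$ are: $P_{j,j}=1-q_j$ for all $j$; for $2\le j\le M-1$, $P_{j,j-1}=q_j\frac{i_{j+1}-i_j}{i_{j+1}-i_{j-1}}$ and $P_{j,j+1}=q_j\frac{i_j-i_{j-1}}{i_{j+1}-i_{j-1}}$; and $P_{j,k}=0$ if $k\notin\{j-1,j,j+1\}$ (the states $i_1,i_M$ are absorbing). If the initial value $y$ lies in $(i_{j-1},i_j)$, the process immediately jumps at time $0$: $\mathbb{P}(X_{0+}=i_j\mid X_0=y)=\frac{y-i_{j-1}}{i_j-i_{j-1}}$, $\mathbb{P}(X_{0+}=i_{j-1}\mid X_0=y)=\frac{i_j-y}{i_j-i_{j-1}}$. Definition of $\mathcal L$ and $\mathcal F$: with $e_0=\sum_j i_jp_j$ and $l$ the index such that $i_{l-1}<e_0\le i_l$, $$\mathcal L(\underline p,j)=\begin{cases}\frac{i_{j+1}-i_{j-1}}{(i_{j+1}-i_j)(i_j-i_{j-1})}\sum_{k=1}^{j-1}(i_j-i_k)p_k & 2\le j\le l-1,\\[1mm] \frac{i_{j+1}-i_{j-1}}{(i_{j+1}-i_j)(i_j-i_{j-1})}\sum_{k=j+1}^{M}(i_k-i_j)p_k & l\le j\le M-1,\\[1mm]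 0 & j=1\text{ or }j=M,\end{cases}$$ and $\mathcal F(\underline p,j)=\mathcal L(\underline p,j)/p_j$ when $\mathcal L(\underline p,j)>0$, $\mathcal F(\underline p,j)=0$ when $\mathcal L(\underline p,j)=0$. *)

(* Defs.v *)
From HB Require Import structures.
From mathcomp Require Import all_boot all_order all_algebra.
From mathcomp Require Import all_classical all_reals all_analysis.

Set Implicit Arguments.
Unset Strict Implicit.
Unset Printing Implicit Defensive.

Import Order.TTheory GRing.Theory Num.Theory.
Import numFieldNormedType.Exports.

Local Open Scope classical_set_scope.
Local Open Scope ring_scope.

(* The states [i_1 < ... < i_M] are the entries                               *)
(* [s`_0 < ... < s`_M.-1] of a tuple, and likewise for p and q: every index   *)
(* is one less than in the usual 1-based notation, so that the interior       *)
(* states are those with [0 < j < M.-1].                                      *)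

Definition mean (R : realType) (M : nat) (s p : M.-tuple R) : R :=
  \sum_(j < M) s`_j * p`_j.

(* [l] stands for the index with [s`_l.-1 < mean s p <= s`_l].                *)
Definition calL (R : realType) (M : nat) (s p : M.-tuple R) (l j : nat) : R :=
  if (0 < j < M.-1)%N then
    (s`_j.+1 - s`_j.-1) / ((s`_j.+1 - s`_j) * (s`_j - s`_j.-1)) *
    (if (j < l)%N then \sum_(0 <= k < j) (s`_j - s`_k) * p`_k
     else \sum_(j.+1 <= k < M) (s`_k - s`_j) * p`_k)
  else 0.

Definition calF (R : realType) (M : nat) (s p : M.-tuple R) (l j : nat) : R :=
  if 0 < calL s p l j then calL s p l j / p`_j else 0.

Definition dmrw_param (R : realType) (M : nat) (q : M.-tuple R) : Prop :=
  [/\ q`_0 = 0, q`_M.-1 = 0 & forall j : 'I_M, 0 <= q`_j <= 1].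

Definition dmrw_tmx (R : realType) (M : nat) (s q : M.-tuple R) : 'M[R]_M :=
  \matrix_(j < M, k < M)
    if k == j then 1 - q`_j
    else if (0 < j < M.-1)%N then
      if (k.+1 == j)%N then q`_j * ((s`_j.+1 - s`_j) / (s`_j.+1 - s`_j.-1))
      else if (k == j.+1 :> nat)%N then
        q`_j * ((s`_j - s`_j.-1) / (s`_j.+1 - s`_j.-1))
      else 0
    else 0.

(* Meaningful only when [P B != 0] (it is 0 otherwise).                       *)
Definition cprob d (T : measurableType d) (R : realType) (P : probability T R)
    (A B : set T) : R :=
  fine (P (A `&` B)) / fine (P B).

(* The sigma-algebra generated by the variables [X n], [n \in D].             *)
Definition sigma_proc d (T : measurableType d) (R : realType)
    (X : nat -> T -> R) (D : set nat) : set_system T :=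
  <<s \bigcup_(n in D) preimage_set_system setT (X n) measurable >>.

Definition martingale d (T : measurableType d) (R : realType)
    (P : probability T R) (X : nat -> {RV P >-> R}) : Prop :=
  (forall n, P.-integrable setT (EFin \o X n)) /\
  forall n (A : set T), sigma_proc X [set m | (m <= n)%N] A ->
    (\int[P]_(w in A) (X n.+1 w)%:E = \int[P]_(w in A) (X n w)%:E)%E.

Definition path_event d (T : measurableType d) (R : realType) (M : nat)
    (s : M.-tuple R) (X : nat -> T -> R) (h : nat -> 'I_M) (n : nat) : set T :=
  [set w | forall m, (m <= n)%N -> X m w = s`_(h m)].

Definition time_homogeneous_markov d (T : measurableType d) (R : realType)
    (P : probability T R) (M : nat) (s : M.-tuple R) (Q : 'M[R]_M)
    (X : nat -> {RV P >-> R}) : Prop :=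
  forall (n : nat) (h : nat -> 'I_M) (k : 'I_M),
    P (path_event s X h n) != 0%E ->
    cprob P (X n.+1 @^-1` [set s`_k]) (path_event s X h n) = Q (h n) k.

(* Initial values outside the state space, which call for an extra jump at    *)
(* time 0, are not covered.                                                   *)
Record dmrw d (T : measurableType d) (R : realType) (P : probability T R)
    (M : nat) (s q : M.-tuple R) (X : nat -> {RV P >-> R}) : Prop := Dmrw {
  dmrw_paramP : dmrw_param q ;
  dmrw_state : forall n w, X n w \in (s : seq R) ;
  dmrw_martingale : martingale X ;
  dmrw_markov : time_homogeneous_markov s (dmrw_tmx s q) X }.

Definition indep_process_time d (T : measurableType d) (R : realType)
    (P : probability T R) (X : nat -> T -> R) (tau : T -> nat) : Prop :=
  forall (A : set T) (B : set nat), sigma_proc X setT A ->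
    P (A `&` tau @^-1` B) = (P A * P (tau @^-1` B))%E.

(* [T, P] is an extension, by means of the measure preserving map [pi], of    *)
(* the probability space [T0, P0] on which the random time [tau] is given;    *)
(* [tau \o pi] is [tau] viewed on the extension, which carries the DMRW [X].  *)
(* [X] starts in both [s`_l] and [s`_l.-1] with positive probability, so that *)
(* conditioning on the initial state is meaningful.                           *)
Record dmrw_solution (R : realType) (M : nat) (s p : M.-tuple R) (l : nat)
    d0 (T0 : measurableType d0) (P0 : probability T0 R) (tau : {RV P0 >-> nat})
    d (T : measurableType d) (P : probability T R) (pi : {mfun T >-> T0})
    (q : M.-tuple R) (X : nat -> {RV P >-> R}) : Prop := DmrwSolution {
  sol_extension :
    forall A : set T0, measurable A -> P (pi @^-1` A) = P0 A ;
  sol_dmrw : dmrw s q X ;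
  sol_indep : indep_process_time P X (tau \o pi) ;
  sol_start : P (X 0%N @^-1` [set s`_l]) != 0%E /\
              P (X 0%N @^-1` [set s`_l.-1]) != 0%E ;
  sol_law : forall j : 'I_M,
    let X_tau := fun w => X (tau (pi w)) w in
    (mean s p - s`_l.-1) / (s`_l - s`_l.-1) *
      cprob P (X_tau @^-1` [set s`_j]) (X 0%N @^-1` [set s`_l]) +
    (s`_l - mean s p) / (s`_l - s`_l.-1) *
      cprob P (X_tau @^-1` [set s`_j]) (X 0%N @^-1` [set s`_l.-1]) = p`_j }.

(* Main.v *)
Require Import Defs.
From HB Require Import structures.
From mathcomp Require Import all_boot all_order all_algebra.
From mathcomp Require Import all_classical all_reals all_analysis.
From mathcomp Require Import measurable_realfun.
From mathcomp Require Import ring lra zify.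

(** Let [v] be the law of the walk at the geometric time, mixed over the two
    initial states with the weights of the theorem, and let [Q] be the transition
    matrix. Since the geometric law has no memory, [v] satisfies
      [v = (1 - a) two_point + a v Q],
    where [two_point] is the law on [s`_l.-1] and [s`_l] with the mean of [p]
    ([law_balance]). As [a Q] contracts the l1 norm of row vectors
    ([discounted_fixpoint_eq0]), [v = p] if and only if [p] satisfies this
    equation ([balance]). The rest of the analysis concerns this linear system
    in the parameters [q].

    Pair the system with a function [f] on the states. The generator [Q - 1]
    sends [f] to [q`_j] times a weighted second difference of [f] at [s`_j], so
    the system reads
      [(1 - a) (E_p f - E_two_point f) = a \sum_j p`_j q`_j second_diff f j].
    If [f] is a hinge function with kink at the interior state [s`_i], its second
    difference vanishes except at [i]; if the hinge opens away from the two
    initial states, the two-point law integrates it to zero. What remains gives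
    [q`_i = (a^-1 - 1) * calF s p l i] ([balance_param]). Conversely, with these
    [q] the system holds for the hinges, and for affine functions because both
    laws have the same mass and mean; these functions span all functions, so the
    system holds ([param_balance]). The numbers [q`_i] are nonnegative, and are
    the parameters of a walk exactly if none exceeds [1].

    It remains to exhibit a walk with given parameters. One uniform variable on
    the unit interval drives the whole chain: each step reads the next state off
    the slot into which the variable falls, and the position within the slot is
    again uniform ([chain_path_prob]). The product with the space carrying the
    random time makes the two independent ([chain_indep]), and the martingale
    property follows from the Markov property since the identity is harmonic for
    [Q] ([markov_martingale]). *)

Set Implicit Arguments.
Unset Strict Implicit.
Unset Printing Implicit Defensive.

Import Order.TTheory GRing.Theory Num.Theory.
Import numFieldNormedType.Exports.

Local Open Scope classical_set_scope.
Local Open Scope ring_scope.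

(** * Hinge functions and the parameters of the walk *)

Section Algebra.
Context {R : realType} {M : nat}.
Implicit Types (s p q : M.-tuple R) (f : nat -> R) (i j k l : nat).

Definition increasing s := forall j k : 'I_M, (j < k)%N -> s`_j < s`_k.

(** The generator of the walk at [s`_j], for unit jump probability: the mean of
    [f] after the jump to a neighbour, minus [f j]. *)
Definition second_diff s f j : R :=
  (s`_j.+1 - s`_j) / (s`_j.+1 - s`_j.-1) * f j.-1 +
  (s`_j - s`_j.-1) / (s`_j.+1 - s`_j.-1) * f j.+1 - f j.

(** The value at its own kink of [second_diff] of a hinge function; the inverse
    of the coefficient of [calL]. *)
Definition gap s i : R :=
  (s`_i.+1 - s`_i) * (s`_i - s`_i.-1) / (s`_i.+1 - s`_i.-1).

Definition left_hinge s i k : R := if (k < i)%N then s`_i - s`_k else 0.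

Definition right_hinge s i k : R := if (i < k)%N then s`_k - s`_i else 0.

Lemma lt_tnth s (hs : increasing s) j k :
  (j < k < M)%N -> s`_j < s`_k.
Proof.
move=> /andP[jk kM]; exact: (hs (Ordinal (ltn_trans jk kM)) (Ordinal kM)).
Qed.

Lemma param_boundary q (j : 'I_M) : dmrw_param q ->
  ~~ (0 < j < M.-1)%N -> q`_j = 0.
Proof.
move=> [q0 qM _] jout.
have [->|->] // : (j = 0 :> nat) \/ (j = M.-1 :> nat).
by have := ltn_ord j; move: jout; lia.
Qed.

Lemma tmx_test s q f (j : 'I_M) : dmrw_param q ->
  \sum_(k < M) dmrw_tmx s q j k * f k = f j + q`_j * second_diff s f j.
Proof.
move=> hq; rewrite (bigD1 j) //= mxE eqxx.
have [jin|jout] := boolP (0 < j < M.-1)%N; last first.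
  rewrite big1 ?addr0; last first.
    by move=> k /negPf kj; rewrite mxE kj (negPf jout) mul0r.
  by rewrite (param_boundary hq jout) subr0 mul1r mul0r addr0.
have hm : (j.-1 < M)%N by lia.
have hp : (j.+1 < M)%N by lia.
pose jm := Ordinal hm; pose jp := Ordinal hp.
have jmj : jm != j by apply/eqP => /(congr1 val) /=; lia.
have jpj : jp != j by apply/eqP => /(congr1 val) /=; lia.
have jpm : jp != jm by apply/eqP => /(congr1 val) /=; lia.
rewrite (bigD1 jm) //= (bigD1 jp) /= ?jpj ?jpm //.
rewrite big1 ?addr0; last first.
  move=> k /andP[/andP[kj kjm] kjp]; rewrite mxE (negPf kj) jin.
  have -> : (k.+1 == j) = false.
    by apply/negP => /eqP h; move/eqP: kjm; apply; apply: val_inj => /=; lia.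
  have -> : (k == j.+1 :> nat) = false.
    by apply/negP => /eqP h; move/eqP: kjp; apply; apply: val_inj => /=; lia.
  by rewrite mul0r.
rewrite !mxE (negPf jmj) (negPf jpj) jin /=.
have -> : (j.-1.+1 == j) by apply/eqP; lia.
have -> : (j.+2 == j) = false by apply/eqP; lia.
rewrite eqxx /second_diff.
by ring.
Qed.

(** Affine functions are harmonic: this is the martingale property of the walk. *)
Lemma second_diff_affine s (hs : increasing s)
    c b j : (0 < j < M.-1)%N ->
  second_diff s (fun k => c + b * s`_k) j = 0.
Proof.
move=> hj; rewrite /second_diff; set x := s`_j.+1; set y := s`_j.-1.
have h : y < x by apply: lt_tnth => //; lia.
by field; lra.
Qed.

(** A hinge is affine on either side of its kink, and the neighbours of any other
    state lie on one side, the kink included. *)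
Lemma second_diff_left_hinge s (hs : increasing s)
    i j : (0 < j < M.-1)%N ->
  second_diff s (left_hinge s i) j = if j == i then gap s i else 0.
Proof.
move=> hj; have [<-|ji] := eqVneq j i.
  rewrite /second_diff /left_hinge /gap ltnn.
  have -> : (j.-1 < j)%N by lia.
  have -> : (j.+1 < j)%N = false by lia.
  by rewrite mulr0 addr0 subr0 mulrAC.
have [jlti|iltj] : (j < i)%N \/ (i < j)%N by lia.
  rewrite -(second_diff_affine hs (s`_i) (-1) hj) /second_diff /left_hinge jlti.
  have -> : (j.-1 < i)%N by lia.
  have [->|h] := eqVneq j.+1 i.
    by rewrite ltnn; ring.
  have -> : (j.+1 < i)%N by lia.
  by ring.
rewrite /second_diff /left_hinge.
have -> : (j.-1 < i)%N = false by lia.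
have -> : (j.+1 < i)%N = false by lia.
have -> : (j < i)%N = false by lia.
by ring.
Qed.

Lemma right_hingeE s i k : right_hinge s i k = left_hinge s i k + (- s`_i + 1 * s`_k).
Proof.
rewrite /right_hinge /left_hinge; case: ltngtP => [| |->]; lra.
Qed.

Lemma second_diff_right_hinge s (hs : increasing s)
    i j : (0 < j < M.-1)%N ->
  second_diff s (right_hinge s i) j = if j == i then gap s i else 0.
Proof.
move=> hj; rewrite -second_diff_left_hinge// -[RHS]addr0.
rewrite -(second_diff_affine hs (- s`_i) 1 hj) /second_diff !right_hingeE.
by ring.
Qed.

(** The weights on [s`_l.-1] and [s`_l] of total mass one and mean [mean s p],
    with which the theorem mixes the two initial states. *)
Definition two_point s p l k : R :=
  (mean s p - s`_l.-1) / (s`_l - s`_l.-1) * (k == l)%:R +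
  (s`_l - mean s p) / (s`_l - s`_l.-1) * (k == l.-1)%:R.

Lemma sum_indic f j : (j < M)%N -> \sum_(k < M) (k == j :> nat)%:R * f k = f j.
Proof.
move=> jM; rewrite (bigD1 (Ordinal jM)) //= eqxx mul1r big1 ?addr0 // => k kj.
suff -> : (k == j :> nat) = false by rewrite mul0r.
by apply/negP => /eqP h; move/eqP: kj; apply; apply: val_inj.
Qed.

Lemma two_point_test s p l f : (0 < l < M)%N ->
  \sum_(k < M) two_point s p l k * f k =
    (mean s p - s`_l.-1) / (s`_l - s`_l.-1) * f l +
    (s`_l - mean s p) / (s`_l - s`_l.-1) * f l.-1.
Proof.
move=> hl; under eq_bigr do rewrite /two_point mulrDl -!mulrA.
rewrite big_split/= -!mulr_sumr !sum_indic ?mulrA //; lia.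
Qed.

(** The equation characterizing the law at an independent geometric time, i.e.
    the row vector [(1 - a) two_point (1 - a Q)^-1]. *)
Definition balance s p l q a :=
  forall k : 'I_M, p`_k = (1 - a) * two_point s p l k +
     a * \sum_(j < M) p`_j * dmrw_tmx s q j k.

(** Pairing [balance] with a function of the state turns a row equation into a
    statement about [second_diff], which is local in [j]. *)
Lemma test_residual s p l q a f : dmrw_param q ->
  \sum_(k < M) (p`_k - (1 - a) * two_point s p l k -
     a * \sum_(j < M) p`_j * dmrw_tmx s q j k) * f k =
  (1 - a) * (\sum_(k < M) p`_k * f k - \sum_(k < M) two_point s p l k * f k) -
  a * \sum_(j < M) p`_j * q`_j * second_diff s f j.
Proof.
move=> hq.
have -> : \sum_(j < M) p`_j * q`_j * second_diff s f j =
  \sum_(k < M) (\sum_(j < M) p`_j * dmrw_tmx s q j k) * f k -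
  \sum_(k < M) p`_k * f k.
  under [X in _ = X - _]eq_bigr do rewrite mulr_suml.
  rewrite exchange_big/= -sumrB; apply: eq_bigr => j _.
  under eq_bigr do rewrite -mulrA.
  rewrite -mulr_sumr tmx_test//; ring.
under eq_bigr do rewrite !mulrBl -!mulrA.
rewrite !sumrB -!mulr_sumr; ring.
Qed.

(** The kink decides the side: the hinge must vanish at both [s`_l.-1] and [s`_l],
    as then the two-point law does not contribute; this is the case distinction
    in [calL]. *)
Definition hinge s l i : nat -> R := if (i < l)%N then left_hinge s i else right_hinge s i.

Lemma second_diff_hinge s (hs : increasing s)
    l i j : (0 < j < M.-1)%N ->
  second_diff s (hinge s l i) j = if j == i then gap s i else 0.
Proof.
by move=> hj; rewrite /hinge; case: ifP => _;
  [exact: second_diff_left_hinge|exact: second_diff_right_hinge].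
Qed.

Lemma gap_gt0 s (hs : increasing s) i :
  (0 < i < M.-1)%N -> 0 < gap s i.
Proof.
move=> hi; rewrite /gap divr_gt0 ?mulr_gt0 ?subr_gt0 //; apply: lt_tnth => //; lia.
Qed.

Lemma two_point_hinge s p l i : (0 < l < M)%N ->
  \sum_(k < M) two_point s p l k * hinge s l i k = 0.
Proof.
move=> hl; rewrite two_point_test // /hinge /left_hinge /right_hinge.
case: ltnP => il.
  have -> : (l < i)%N = false by lia.
  have -> : (l.-1 < i)%N = false by lia.
  by rewrite !mulr0 addr0.
have -> : (i < l)%N = false by lia.
have -> : (i < l.-1)%N = false by lia.
by rewrite !mulr0 addr0.
Qed.

Lemma calLE s p l i : (0 < i < M.-1)%N ->
  calL s p l i = (gap s i)^-1 * \sum_(k < M) p`_k * hinge s l i k.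
Proof.
move=> hi; rewrite /calL hi /gap invf_div; congr (_ * _).
rewrite /hinge; case: ifP => il.
  rewrite (big_nat_widen _ _ M) /=; last by lia.
  rewrite big_mkcond big_mkord; apply: eq_bigr => k _ /=.
  by rewrite /left_hinge; case: ifP => _; rewrite ?mulr0 // mulrC.
rewrite (big_nat_widenl i.+1 0) //= big_mkcond big_mkord.
apply: eq_bigr => k _ /=.
by rewrite /right_hinge; case: ifP => _; rewrite ?mulr0 // mulrC.
Qed.

(** The side of the kink on which the hinge is positive always contains a state,
    the lowest or the top one, and that state is charged by [p]. *)
Lemma calL_gt0 s p l i (hs : increasing s)
  (hp : forall j : 'I_M, 0 < p`_j) : (0 < i < M.-1)%N -> 0 < calL s p l i.
Proof.
move=> hi; rewrite calLE // mulr_gt0 ?invr_gt0 ?gap_gt0 //.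
have h0 (k : 'I_M) : 0 <= p`_k * hinge s l i k.
  apply: mulr_ge0; first exact/ltW.
  rewrite /hinge /left_hinge /right_hinge; case: ifP => _; case: ifP => ki //;
    rewrite subr_ge0 ltW //; apply: lt_tnth => //;
    have := ltn_ord k; lia.
have [il|il] := boolP (i < l)%N.
  have hM : (0 < M)%N by lia.
  apply: (@lt_le_trans _ _ (p`_0 * hinge s l i 0)).
    rewrite /hinge il /left_hinge; case/andP: (hi) => -> _.
    by rewrite mulr_gt0 ?(hp (Ordinal hM)) // subr_gt0 lt_tnth //; lia.
  by rewrite (bigD1 (Ordinal hM)) //= lerDl sumr_ge0.
have hM : (M.-1 < M)%N by lia.
apply: (@lt_le_trans _ _ (p`_M.-1 * hinge s l i M.-1)).
  rewrite /hinge (negPf il) /right_hinge; case/andP: (hi) => _ ->.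
  by rewrite mulr_gt0 ?(hp (Ordinal hM)) // subr_gt0 lt_tnth //; lia.
by rewrite (bigD1 (Ordinal hM)) //= lerDl sumr_ge0.
Qed.

Lemma calFE s p l i (hs : increasing s)
  (hp : forall j : 'I_M, 0 < p`_j) : (0 < i < M.-1)%N ->
  calF s p l i = (gap s i)^-1 * (\sum_(k < M) p`_k * hinge s l i k) / p`_i.
Proof. by move=> hi; rewrite /calF calL_gt0 // calLE. Qed.

(** Only the kink survives, so testing with a hinge isolates one parameter. *)
Lemma sum_hinge s p q l i (hs : increasing s) :
  dmrw_param q -> (0 < i < M.-1)%N ->
  \sum_(j < M) p`_j * q`_j * second_diff s (hinge s l i) j =
  p`_i * q`_i * gap s i.
Proof.
move=> hq hi; have iM : (i < M)%N by lia.
rewrite (bigD1 (Ordinal iM)) //= second_diff_hinge // eqxx.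
rewrite big1 ?addr0 // => j ji.
have [jin|jout] := boolP (0 < j < M.-1)%N; last first.
  by rewrite (param_boundary hq jout) mulr0 mul0r.
rewrite second_diff_hinge //; case: eqP => [h|]; last by rewrite mulr0.
by move/eqP: ji; case; apply: val_inj.
Qed.

(** The two-point law gives no weight to the hinge with kink at [i], hence
    [(1 - a) * E_p(hinge) = a * p`_i * q`_i * gap s i]. *)
Lemma balance_param s p q l a
    (hs : increasing s)
    (hp : forall j : 'I_M, 0 < p`_j) (hl : (0 < l < M)%N) (ha : 0 < a < 1) :
  dmrw_param q -> balance s p l q a ->
  forall i, (0 < i < M.-1)%N -> q`_i = (a^-1 - 1) * calF s p l i.
Proof.
move=> hq hb i hi; rewrite calFE //.
have := test_residual s p l a (hinge s l i) hq.
rewrite two_point_hinge // sum_hinge // big1; last first.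
  by move=> k _; rewrite -addrA -opprD -hb subrr mul0r.
have g0 := gap_gt0 hs hi; have iM : (i < M)%N by lia.
have p0 := hp (Ordinal iM); rewrite /= in p0.
set S := \sum_(k < M) _ => h.
have hS : (1 - a) * S = a * (p`_i * q`_i * gap s i) by lra.
have -> : q`_i = (1 - a) * S / (a * p`_i * gap s i) by rewrite hS; field; lra.
by field; lra.
Qed.

(** Constants, the identity and the hinges span all functions on the states. As
    [left_hinge s i] is supported below [i], orthogonality to the next hinge
    kills the masses one at a time, from the lowest state up. *)
Lemma orth_hinge_eq0 s (m : 'I_M -> R)
    (hs : increasing s) :
  \sum_(k < M) m k = 0 -> \sum_(k < M) m k * s`_k = 0 ->
  (forall i, (0 < i < M.-1)%N -> \sum_(k < M) m k * left_hinge s i k = 0) ->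
  forall k : 'I_M, m k = 0.
Proof.
move=> m0 m1 mhinge.
have hingeM i : (0 < i < M)%N -> \sum_(k < M) m k * left_hinge s i k = 0.
  (* The hinge with kink at the top state is affine on the states. *)
  move=> hi; have [->|iM] := eqVneq i M.-1; last by apply: mhinge; lia.
  transitivity (\sum_(k < M) (s`_M.-1 * m k - m k * s`_k)).
    apply: eq_bigr => k _; rewrite /left_hinge; case: ltnP => kM; first by ring.
    have -> : (k : nat) = M.-1 by have := ltn_ord k; lia.
    by ring.
  by rewrite sumrB -mulr_sumr m0 m1 mulr0 subr0.
have mlt (n : nat) (k : 'I_M) : k = n :> nat -> (n < M.-1)%N -> m k = 0.
  elim/ltn_ind: n k => n IH k kn nM.
  have h : (0 < n.+1 < M)%N by lia.
  have := hingeM _ h; rewrite (bigD1 k) //= big1 ?addr0.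
    rewrite /left_hinge kn ltnSn => /eqP; rewrite mulf_eq0 => /orP[/eqP //|].
    by rewrite subr_eq0 gt_eqF // lt_tnth //; lia.
  move=> j jk; rewrite /left_hinge; case: ltnP => jn; last by rewrite mulr0.
  rewrite (IH j) ?mul0r //; last by lia.
  by move: jk; rewrite -val_eqE /=; lia.
move=> k; have [kM|kM] := ltnP k M.-1; first exact: (mlt k).
move: m0; rewrite (bigD1 k) //= big1 ?addr0 // => j jk.
apply: (mlt j) => //.
by move: jk; rewrite -val_eqE /=; have := ltn_ord j; have := ltn_ord k; lia.
Qed.

(** The residual of [balance] is a signed measure annihilating affine functions,
    because [p] and the two-point law have equal masses and means, and hinges, by
    the choice of [q]; hence it vanishes. *)
Lemma param_balance s p q l a
    (hs : increasing s)
    (hp : forall j : 'I_M, 0 < p`_j) (hp1 : \sum_(j < M) p`_j = 1)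
    (hl : (0 < l < M)%N) (ha : 0 < a < 1) :
  dmrw_param q ->
  (forall i, (0 < i < M.-1)%N -> q`_i = (a^-1 - 1) * calF s p l i) ->
  balance s p l q a.
Proof.
move=> hq qE.
pose m (k : 'I_M) := p`_k - (1 - a) * two_point s p l k -
     a * \sum_(j < M) p`_j * dmrw_tmx s q j k.
have sl : s`_l.-1 < s`_l by apply: lt_tnth => //; lia.
have maff c b : \sum_(k < M) m k * (c + b * s`_k) = 0.
  rewrite (test_residual s p l a (fun k => c + b * s`_k) hq).
  rewrite (two_point_test s p (fun k => c + b * s`_k) hl) [X in _ - a * X]big1; last first.
    move=> j _; have [jin|jout] := boolP (0 < j < M.-1)%N.
      by rewrite second_diff_affine // mulr0.
    by rewrite (param_boundary hq jout) mulr0 mul0r.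
  have -> : \sum_(k < M) p`_k * (c + b * s`_k) = c + b * mean s p.
    rewrite /mean mulr_sumr -[in RHS](mulr1 c) -hp1 mulr_sumr -big_split /=.
    by apply: eq_bigr => k _; ring.
  by field; lra.
have mhinge i : (0 < i < M.-1)%N -> \sum_(k < M) m k * left_hinge s i k = 0.
  move=> hi; transitivity (\sum_(k < M) m k * hinge s l i k).
    rewrite /hinge; case: ifP => // _.
    have := maff (- s`_i) 1; under [X in _ -> _ = X]eq_bigr do rewrite right_hingeE mulrDr.
    by rewrite big_split /= => ->; rewrite addr0.
  rewrite test_residual // two_point_hinge // sum_hinge // qE // calFE //.
  have g0 := gap_gt0 hs hi; have iM : (i < M)%N by lia.
  have p0 := hp (Ordinal iM); rewrite /= in p0.
  by field; lra.
move=> k; have /eqP : m k = 0.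
  apply: (orth_hinge_eq0 hs) => //.
    by apply: etrans (maff 1 0); apply: eq_bigr => j _; ring.
  by apply: etrans (maff 0 1); apply: eq_bigr => j _; ring.
by rewrite /m; lra.
Qed.

Lemma tmx_ge0 s q (hs : increasing s)
  (j k : 'I_M) : dmrw_param q -> 0 <= dmrw_tmx s q j k.
Proof.
move=> [_ _ hq]; have /andP[q0 q1] := hq j; rewrite mxE.
case: ifP => _; first by rewrite subr_ge0.
case: ifP => // jin.
have h1 : s`_j.-1 < s`_j by apply: lt_tnth => //; lia.
have h2 : s`_j < s`_j.+1 by apply: lt_tnth => //; lia.
by case: ifP => _; [|case: ifP => // _]; rewrite mulr_ge0 ?divr_ge0 //; lra.
Qed.

Lemma sum_tmx s q (hs : increasing s)
  (j : 'I_M) c b : dmrw_param q ->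
  \sum_(k < M) dmrw_tmx s q j k * (c + b * s`_k) = c + b * s`_j.
Proof.
move=> hq; rewrite (tmx_test s (fun k => c + b * s`_k) j hq).
have [jin|jout] := boolP (0 < j < M.-1)%N.
  by rewrite second_diff_affine // mulr0 addr0.
by rewrite (param_boundary hq jout) mul0r addr0.
Qed.

(** Right multiplication by a stochastic matrix does not increase the l1 norm of
    a row vector, so [a Q] is a strict contraction. *)
Lemma discounted_fixpoint_eq0 (Q : 'M[R]_M) a (x : 'I_M -> R) : 0 <= a < 1 ->
  (forall j k : 'I_M, 0 <= Q j k) -> (forall j : 'I_M, \sum_(k < M) Q j k = 1) ->
  (forall k : 'I_M, x k = a * \sum_(j < M) x j * Q j k) -> forall k : 'I_M, x k = 0.
Proof.
move=> /andP[a0 a1] Q0 Q1 hx.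
have hle : \sum_(k < M) `|x k| <= a * \sum_(k < M) `|x k|.
  rewrite [leRHS]mulr_sumr.
  under [leRHS]eq_bigr => j _ do rewrite -[`|x j|]mulr1 -(Q1 j) mulr_sumr mulr_sumr.
  rewrite exchange_big /=; apply: ler_sum => k _.
  rewrite {1}hx normrM (ger0_norm a0) -mulr_sumr ler_wpM2l //.
  apply: le_trans (ler_norm_sum _ _ _) _; apply: ler_sum => j _.
  by rewrite normrM (ger0_norm (Q0 _ _)).
have s0 : 0 <= \sum_(k < M) `|x k| by rewrite sumr_ge0.
have : \sum_(k < M) `|x k| = 0 by nra.
move=> /eqP; rewrite psumr_eq0 // => /allP h k.
by apply/eqP; rewrite -normr_eq0; apply: h; rewrite mem_index_enum.
Qed.
End Algebra.

Local Notation Pr P A := (fine (P A)).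

(** * The law of a Markov chain at an independent geometric time *)

Section Law.
Context d (T : measurableType d) (R : realType) (P : probability T R).
Context (M : nat) (s : M.-tuple R) (X : nat -> {RV P >-> R}).
Hypothesis hs : increasing s.
Hypothesis Xs : forall n w, X n w \in (s : seq R).

Lemma PrE (A : set T) : measurable A -> P A = (Pr P A)%:E.
Proof. by move=> mA; rewrite fineK // fin_num_measure. Qed.

Definition at_state n (j : nat) : set T := X n @^-1` [set s`_j].

Lemma measurable_at_state n j : measurable (at_state n j).
Proof. by rewrite -[at_state _ _]setTI; apply: measurable_funP. Qed.

Lemma nth_inj (j k : 'I_M) : s`_j = s`_k -> j = k.
Proof.
move=> e; apply: val_inj; apply/eqP; case: (ltngtP j k) => // h.
- by have := hs h; rewrite e ltxx.
- by have := hs h; rewrite e ltxx.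
Qed.

Lemma at_stateP n w : exists j : 'I_M, at_state n j w.
Proof.
have /(nthP 0)[j jM e] := Xs n w; rewrite size_tuple in jM.
by exists (Ordinal jM).
Qed.

Lemma at_state_inj n w (j k : 'I_M) :
  at_state n j w -> at_state n k w -> j = k.
Proof. by rewrite /at_state /= => -> /nth_inj. Qed.

Lemma Pr_split n (B : set T) : measurable B ->
  Pr P B = \sum_(j < M) Pr P (B `&` at_state n j).
Proof.
move=> mB; have mF (j : 'I_M) : measurable (B `&` at_state n j).
  by apply: measurableI => //; exact: measurable_at_state.
apply: EFin_inj; rewrite -PrE // -sumEFin.
under eq_bigr do rewrite -PrE //.
rewrite -(@measure_bigsetU_ord _ _ _ P M xpredT (fun j => B `&` at_state n j)) //.
  congr (P _); apply/seteqP; split => [w Bw|w].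
    have [j hj] := at_stateP n w.
    by rewrite -bigcup_seq; exists j => //=; rewrite mem_index_enum.
  by rewrite -bigcup_seq => -[j _ []].
move=> j k _ _ [w [[_ hj] [_ hk]]]; exact: at_state_inj hj hk.
Qed.

(** Only the dependence on the trajectory is recorded; measurability is asked for
    separately. *)
Definition past n : set_system T := fun A =>
  forall w w', (forall m, (m <= n)%N -> X m w = X m w') -> A w -> A w'.

Context (Q : 'M[R]_M).
Hypothesis hX : time_homogeneous_markov s Q X.

Lemma measurable_path_event h n : measurable (path_event s X h n).
Proof.
rewrite (_ : path_event _ _ _ _ = \bigcap_(m in [set m | (m <= n)%N]) at_state m (h m)).
  by apply: bigcap_measurableType => // m _; exact: measurable_at_state.
by apply/seteqP; split => w hw m /= hm; exact: hw.
Qed.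

Lemma Pr_path_step h n (k : 'I_M) :
  Pr P (path_event s X h n `&` at_state n.+1 k) = Pr P (path_event s X h n) * Q (h n) k.
Proof.
have mE := measurable_path_event h n.
have mI : measurable (path_event s X h n `&` at_state n.+1 k).
  by apply: measurableI => //; exact: measurable_at_state.
have [E0|E0] := eqVneq (P (path_event s X h n)) 0%E.
  rewrite E0 /= mul0r.
  suff -> : P (path_event s X h n `&` at_state n.+1 k) = 0%E by [].
  by apply: (subset_measure0 mI mE) => //; exact: subIsetl.
have := hX k E0; rewrite /cprob setIC => <-.
rewrite mulrC divfK //; apply: contraNneq E0 => h0.
by rewrite PrE // h0.
Qed.

(** The Markov property, extended from single paths to every event of the past:
    splitting by the value at times [0], ..., [n] leaves pieces which are whole
    path events or empty. *)
Lemma Pr_past_step n (A : set T) (j k : 'I_M) : measurable A -> past n A ->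
  Pr P (A `&` at_state n j `&` at_state n.+1 k) = Pr P (A `&` at_state n j) * Q j k.
Proof.
move=> mA pA.
pose E r (h : nat -> 'I_M) : set T := [set w | forall m, (m < r)%N -> at_state m (h m) w].
have mE r h : measurable (E r h).
  rewrite (_ : E r h = \bigcap_(m in [set m | (m < r)%N]) at_state m (h m)).
    by apply: bigcap_measurableType => // m _; exact: measurable_at_state.
  by apply/seteqP; split => w hw m /= hm; exact: hw.
(* [r] coordinates of the path are already prescribed, [c] are still free. *)
have key c r h : (c + r = n.+1)%N ->
  Pr P (E r h `&` (A `&` at_state n j) `&` at_state n.+1 k) =
  Pr P (E r h `&` (A `&` at_state n j)) * Q j k.
  elim: c r h => [|c IH] r h crn.
    rewrite add0n in crn; rewrite crn.
    have [[w0 [Ew0 [Aw0 jw0]]]|noA] :=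
        pselect (exists w, (E n.+1 h `&` (A `&` at_state n j)) w).
      have hnj : h n = j by apply: at_state_inj jw0; exact: Ew0.
      have -> : E n.+1 h `&` (A `&` at_state n j) = path_event s X h n.
        apply/seteqP; split => [w [Ew _] m mn|w hw]; first exact: Ew.
        split; first by move=> m mn; exact: hw.
        split; last by rewrite /at_state /= hw // hnj.
        by apply: pA Aw0 => m mn; rewrite hw //; exact: Ew0.
      by rewrite Pr_path_step hnj.
    have -> : E n.+1 h `&` (A `&` at_state n j) = set0.
      by apply/seteqP; split => w // hw; apply: noA; exists w.
    by rewrite set0I measure0 mul0r.
  have mB : measurable (E r h `&` (A `&` at_state n j)).
    by apply: measurableI => //; apply: measurableI => //; exact: measurable_at_state.
  rewrite (Pr_split r); last first.
    by apply: measurableI => //; exact: measurable_at_state.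
  rewrite [in RHS](Pr_split r) // mulr_suml; apply: eq_bigr => i _.
  pose h' m := if m == r then i else h m.
  have EE (C : set T) : E r h `&` C `&` at_state r i = E r.+1 h' `&` C.
    apply/seteqP; split => w.
      move=> [[Ew Cw] iw]; split=> // m; rewrite ltnS leq_eqVlt /h'.
      by case: eqVneq => [-> //|_] /=; exact: Ew.
    move=> [Ew Cw]; split; last by have := Ew r (ltnSn r); rewrite /h' eqxx.
    split=> // m mr; have := Ew m (ltnW mr).
    by rewrite /h' ltn_eqF.
  by rewrite -setIA [at_state _ k `&` _]setIC setIA !EE IH //; lia.
have hE : E 0%N (fun=> j) = setT by apply/seteqP; split.
by have := key n.+1 0%N (fun=> j) (addn0 _); rewrite hE !setTI.
Qed.

Lemma sigma_procW n A :
  sigma_proc X [set m | (m <= n)%N] A -> measurable A /\ past n A.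
Proof.
pose D := [set m | (m <= n)%N].
suff [h1 h2] : sigma_proc X D `<=` measurable /\ sigma_proc X D `<=` past n.
  by move=> hA; split; [exact: h1|exact: h2].
split; apply: smallest_sub.
- exact: sigma_algebra_measurable.
- by move=> C [m _ [B mB <-]]; apply: measurable_funP.
- split.
  + by [].
  + move=> C pC w w' hw [_ nAw]; split=> // Aw'; apply: nAw.
    by apply: pC Aw' => m hm; rewrite hw.
  + move=> F pF w w' hw [i _ Fw]; exists i => //; exact: pF hw Fw.
- by move=> C [m /= hm [B mB <-]] w w' hw [_ /= Bw]; split => //=; rewrite -hw.
Qed.

Lemma integral_at_state n (A : set T) : measurable A ->
  (\int[P]_(w in A) (X n w)%:E)%E =
  (\sum_(j < M) s`_j * Pr P (A `&` at_state n j))%:E.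
Proof.
move=> mA; pose F (j : 'I_M) := A `&` at_state n j.
have mF j : measurable (F j).
  by apply: measurableI => //; exact: measurable_at_state.
have AE : A = \big[setU/set0]_(j <- index_enum 'I_M) F j.
  apply/seteqP; split => [w Aw|w].
    have [j hj] := at_stateP n w.
    by rewrite -bigcup_seq; exists j => //=; rewrite mem_index_enum.
  by rewrite -bigcup_seq => -[j _ []].
have tF : trivIset [set` index_enum 'I_M] F.
  by move=> j k _ _ [w [[_ hj] [_ hk]]]; exact: at_state_inj hj hk.
rewrite {1}AE (integral_bigsetU_EFin _ mF (index_enum_uniq _) tF); last first.
  by apply/measurable_EFinP; apply: measurable_funTS.
rewrite -sumEFin; apply: eq_bigr => j _.
transitivity (\int[P]_(w in F j) (cst (s`_j)%:E w))%E.
  by apply: eq_integral => w; rewrite inE /F /at_state /= => -[_ ->].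
by rewrite integral_cst // EFinM; congr (_ * _)%E; exact: PrE.
Qed.

(** By [Pr_past_step], the mean zero of the increment out of each state persists
    when the trajectory is restricted to an event of the past. *)
Lemma markov_martingale :
  (forall j : 'I_M, \sum_(k < M) Q j k * s`_k = s`_j) -> martingale X.
Proof.
move=> Qs; split.
  move=> n; apply: measurable_bounded_integrable => //.
  - by apply: le_lt_trans (probability_le1 P measurableT) _; rewrite ltry.
  exists (\sum_(j < M) `|s`_j|); split; first exact: num_real.
  move=> y hy w _ /=; apply: le_trans (ltW hy).
  have [j ->] := at_stateP n w.
  by rewrite (bigD1 j) //= lerDl sumr_ge0.
move=> n A /sigma_procW [mA pA].
rewrite !integral_at_state //; congr EFin.
have mk k : measurable (A `&` at_state n.+1 k).
  by apply: measurableI => //; exact: measurable_at_state.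
under eq_bigr => k _ do rewrite (Pr_split n (mk k)) mulr_sumr.
rewrite exchange_big /=; apply: eq_bigr => j _.
rewrite -Qs mulr_suml; apply: eq_bigr => k _.
by rewrite setIAC Pr_past_step //; ring.
Qed.

Definition joint i n k := Pr P (at_state 0 i `&` at_state n k).

Lemma joint0 (i k : 'I_M) : joint i 0 k = Pr P (at_state 0 i) * (k == i)%:R.
Proof.
rewrite /joint; case: eqVneq => [->|ki]; first by rewrite setIid mulr1.
rewrite (_ : _ `&` _ = set0) ?measure0 ?mulr0 //.
apply/seteqP; split => w // [hi hk].
by move/eqP: ki; apply; exact: at_state_inj hk hi.
Qed.

Lemma jointS (i k : 'I_M) n :
  joint i n.+1 k = \sum_(j < M) joint i n j * Q j k.
Proof.
rewrite /joint (Pr_split n); last first.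
  by apply: measurableI; exact: measurable_at_state.
apply: eq_bigr => j _; rewrite setIAC.
apply: Pr_past_step; first exact: measurable_at_state.
by move=> w w' /(_ 0%N (leq0n _)); rewrite /at_state /= => ->.
Qed.

Context (a : R) (sigma : T -> nat).
Hypothesis msigma : forall n, measurable (sigma @^-1` [set n]).
Hypothesis hsigma : forall n, P (sigma @^-1` [set n]) = ((1 - a) * a ^+ n)%:E.
Hypothesis hind : indep_process_time P X sigma.

Definition stopped i k := Pr P ((fun w => X (sigma w) w) @^-1` [set s`_k] `&` at_state 0 i).

Lemma sigma_proc_at_state (D : set nat) n j : D n -> sigma_proc X D (at_state n j).
Proof.
move=> Dn; apply: sub_sigma_algebra; exists n => //.
by exists [set s`_j] => //; rewrite setTI.
Qed.

Lemma stopped_series (i k : 'I_M) :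
  series (fun n => (1 - a) * a ^+ n * joint i n k) @ \oo --> stopped i k.
Proof.
pose F n := at_state 0 i `&` at_state n k `&` sigma @^-1` [set n].
have mF n : measurable (F n).
  by apply: measurableI => //; apply: measurableI; exact: measurable_at_state.
have FE n : P (F n) = ((1 - a) * a ^+ n * joint i n k)%:E.
  rewrite /F hind; last first.
    by apply: (@measurableI _ (g_sigma_algebraType _)); exact: sigma_proc_at_state.
  rewrite PrE; last by apply: measurableI; exact: measurable_at_state.
  by rewrite -/(joint i n k) hsigma -EFinM mulrC.
have UF : (fun w => X (sigma w) w) @^-1` [set s`_k] `&` at_state 0 i = \bigcup_n F n.
  apply/seteqP; split => [w [hk hi]|w [n _ [[hi hk] /= hn]]].
    by exists (sigma w) => //; split.
  by split => //=; rewrite hn.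
have tF : trivIset setT F.
  by move=> n m _ _ [w [[_ /= hn] [_ /= hm]]]; rewrite -hn -hm.
have mU : measurable (\bigcup_n F n) by exact: bigcup_measurable.
have := @measure_semi_sigma_additive _ _ _ P F mF tF mU.
rewrite /stopped UF => hcvg; pose u := series (fun n => (1 - a) * a ^+ n * joint i n k).
suff h : (EFin \o u) @ \oo --> (Pr P (\bigcup_n F n))%:E by exact: (fine_cvg h).
rewrite -PrE // (_ : EFin \o u = (fun n => \sum_(0 <= i < n) P (F i))%E); first exact: hcvg.
by apply/funext => n /=; rewrite /u /series /= -sumEFin; apply: eq_bigr.
Qed.

(** Memorylessness of the geometric law: the term at time [0] splits off from the
    series over the value of [sigma], and the rest is the series itself after one
    step of the chain, discounted by [a]. *)
Lemma stopped_balance (i k : 'I_M) :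
  stopped i k = (1 - a) * (Pr P (at_state 0 i) * (k == i)%:R)
    + a * \sum_(j < M) stopped i j * Q j k.
Proof.
have h1 : series (fun n => (1 - a) * a ^+ n * joint i n k) n.+1 @[n --> \oo]
   --> stopped i k.
  by have := @stopped_series i k; rewrite -(cvg_shiftS _).
apply: (cvg_unique _ h1) => //.
have -> : (fun n => series (fun n => (1 - a) * a ^+ n * joint i n k) n.+1) =
  (fun n => (1 - a) * (Pr P (at_state 0 i) * (k == i)%:R) +
     a * \sum_(j < M) series (fun n => (1 - a) * a ^+ n * joint i n j) n * Q j k).
  apply/funext => n; rewrite /series /= big_nat_recl //= expr0 mulr1 joint0.
  congr (_ + _); under eq_bigr do rewrite jointS.
  under [in RHS]eq_bigr do rewrite mulr_suml.
  rewrite exchange_big /= mulr_sumr; apply: eq_bigr => m _.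
  by rewrite !mulr_sumr; apply: eq_bigr => j _; rewrite exprS; ring.
apply: cvgD; first exact: cvg_cst.
apply: cvgMl_tmp.
apply: cvg_big => [|j _]; last by apply: cvgMr_tmp; exact: stopped_series.
by move=> x; exact: add_continuous.
Qed.

(** The mixture over the two initial states of the laws at time [sigma] inherits
    the equation by linearity, the initial masses becoming the two-point law. *)
Lemma law_balance (p : M.-tuple R) l (k : 'I_M) :
  (0 < l < M)%N -> P (at_state 0 l) != 0%E -> P (at_state 0 l.-1) != 0%E ->
  let v (k : 'I_M) :=
    (mean s p - s`_l.-1) / (s`_l - s`_l.-1) *
      cprob P ((fun w => X (sigma w) w) @^-1` [set s`_k]) (at_state 0 l) +
    (s`_l - mean s p) / (s`_l - s`_l.-1) *
      cprob P ((fun w => X (sigma w) w) @^-1` [set s`_k]) (at_state 0 l.-1) in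
  v k = (1 - a) * two_point s p l k + a * \sum_(j < M) v j * Q j k.
Proof.
move=> hl Pl Pl1 /=; rewrite /two_point /cprob.
set al := _ / _; set be := _ / (s`_l - _).
have lM : (l < M)%N by lia.
have lM1 : (l.-1 < M)%N by lia.
have mE j : measurable (at_state 0 j) by exact: measurable_at_state.
have n0 (j : nat) : P (at_state 0 j) != 0%E -> Pr P (at_state 0 j) != 0.
  by apply: contraNneq => h; rewrite PrE // h.
have := stopped_balance (Ordinal lM) k; rewrite /stopped -!val_eqE /= => E1.
have := stopped_balance (Ordinal lM1) k; rewrite /stopped -!val_eqE /= => E2.
rewrite E1 E2.
set X1 := \sum_(j < M) _; set X2 := \sum_(j < M) _; set X3 := \sum_(j < M) _.
have -> : X3 = al * (X1 / Pr P (at_state 0 l)) + be * (X2 / Pr P (at_state 0 l.-1)).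
  rewrite /X1 /X2 !mulr_suml !mulr_sumr -big_split /=.
  by apply: eq_bigr => j _; ring.
have := n0 _ Pl; have := n0 _ Pl1 => h1 h2.
by field; rewrite h1 h2.
Qed.
End Law.

(** * A Markov chain driven by one uniform variable *)

Section Chain.
Context {R : realType} {m : nat}.
Local Notation I := 'I_m.+1.
Implicit Types (mu : I -> R) (u x y : R).

Definition prob_vector mu := (forall k, 0 <= mu k) /\ \sum_k mu k = 1.

Definition cum mu n : R := \sum_(k < m.+1 | (k < n)%N) mu k.

Definition slot mu (k : I) : set R := `[cum mu k, cum mu k + mu k[.

Definition sample mu u : I := odflt ord0 [pick k | u \in slot mu k].

(** Inverse transform sampling that keeps the randomness: given that a uniform
    variable falls into a slot, its rescaled position in the slot is again
    uniform, and serves for the next step. *)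
Definition step mu u : I * R :=
  let k := sample mu u in (k, (u - cum mu k) / mu k).

Lemma cumS mu (k : I) : cum mu k.+1 = cum mu k + mu k.
Proof.
rewrite /cum (bigD1 k) ?ltnSn //= addrC; congr (_ + _).
by apply: eq_bigl => j; rewrite ltnS -val_eqE /=; lia.
Qed.

Lemma le_cum mu n n' : (forall k, 0 <= mu k) -> (n <= n')%N ->
  cum mu n <= cum mu n'.
Proof.
move=> mu0 nn'; rewrite /cum [leLHS]big_mkcond [leRHS]big_mkcond /=.
apply: ler_sum => k _; case: ltnP => kn; case: ltnP => kn' //; lia.
Qed.

Lemma cum0 mu : cum mu 0 = 0.
Proof. by rewrite /cum big_pred0. Qed.

Lemma cum_top mu : prob_vector mu -> cum mu m.+1 = 1.
Proof. by move=> [_ <-]; apply: eq_bigl => k; rewrite ltn_ord. Qed.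

Lemma slot_unique mu u j k : prob_vector mu -> slot mu j u -> slot mu k u -> j = k.
Proof.
move=> [mu0 _]; rewrite /slot /= !in_itv /= -!cumS => /andP[j1 j2] /andP[k1 k2].
apply: val_inj; case: (ltngtP j k) => // h.
- by exfalso; have := le_cum mu0 h; lra.
- by exfalso; have := le_cum mu0 h; lra.
Qed.

Lemma slot_exists mu u : prob_vector mu -> 0 <= u < 1 -> exists k, slot mu k u.
Proof.
move=> hmu /andP[u0 u1].
have ex : exists n, u < cum mu n by exists m.+1; rewrite cum_top.
case: (ex_minnP ex) => -[|n] hn min; first by move: hn; rewrite cum0; lra.
have nm : (n < m.+1)%N by apply: min; rewrite cum_top.
exists (Ordinal nm); have /= := cumS mu (Ordinal nm).
rewrite /slot /= in_itv /= => <-; rewrite hn andbT leNgt.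
by apply/negP => /min; rewrite ltnn.
Qed.

Lemma slot_sample mu u k : prob_vector mu -> slot mu k u -> sample mu u = k.
Proof.
move=> hmu ku; rewrite /sample; case: pickP => [j|/(_ k)]; last by rewrite mem_set.
by rewrite inE => ju; exact: slot_unique ju ku.
Qed.

Lemma sample_slot mu u : prob_vector mu -> 0 <= u < 1 -> slot mu (sample mu u) u.
Proof.
by move=> hmu /(slot_exists hmu) [k ku]; rewrite (slot_sample hmu ku).
Qed.

Lemma slot_unit mu k u : prob_vector mu -> slot mu k u -> 0 <= u < 1.
Proof.
move=> hmu; have [mu0 _] := hmu; rewrite /slot /= in_itv /= -cumS => /andP[ku uk].
apply/andP; split.
  by rewrite -(cum0 mu); apply: le_trans ku; exact: le_cum.
by rewrite -(cum_top hmu); apply: lt_le_trans uk _; exact: le_cum.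
Qed.

Lemma step_unit mu u : prob_vector mu -> 0 <= u < 1 -> 0 <= (step mu u).2 < 1.
Proof.
move=> hmu /(sample_slot hmu); rewrite /slot /= in_itv /=.
set c := cum _ _; set d := mu _ => /andP[h1 h2].
have d0 : 0 < d by lra.
by rewrite ler_pdivlMr // ltr_pdivrMr //; lra.
Qed.

Lemma stepP mu u k x y : prob_vector mu -> 0 <= x -> y <= 1 ->
  [/\ 0 <= u < 1, (step mu u).1 = k & x <= (step mu u).2 < y] <->
  cum mu k + mu k * x <= u < cum mu k + mu k * y.
Proof.
move=> hmu x0 y1; split.
  move=> [u01 <-]; have := sample_slot hmu u01; rewrite /slot /= in_itv /=.
  set c := cum _ _; set d := mu _ => /andP[h1 h2].
  have d0 : 0 < d by lra.
  by rewrite ler_pdivlMr // ltr_pdivrMr //; lra.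
move=> /andP[h1 h2].
have d0 : 0 <= mu k by case: hmu.
have ku : slot mu k u by rewrite /slot /= in_itv /=; nra.
have [d1 d2] := (slot_unit hmu ku, slot_sample hmu ku).
split => //; rewrite /step d2 /=.
have d3 : 0 < mu k by move: ku; rewrite /slot /= in_itv /=; lra.
by rewrite ler_pdivlMr // ltr_pdivrMr //; lra.
Qed.

(** The default value of [sample] adds to the slot of [ord0] the points lying in
    no slot. *)
Lemma measurable_sample mu k : prob_vector mu -> measurable [set u | sample mu u = k].
Proof.
move=> hmu; rewrite (_ : [set _ | _] = slot mu k `|`
    [set u | k = ord0 /\ ~ exists j, slot mu j u]).
  apply: measurableU; first exact: measurable_itv.
  have [->|k0] := eqVneq k ord0.
    rewrite (_ : [set _ | _] = ~` \bigcup_(j in setT) slot mu j).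
      apply: measurableC; apply: fin_bigcup_measurable => // j _.
      exact: measurable_itv.
    apply/seteqP; split => u /=.
      by move=> [_ h] [j _ ju]; apply: h; exists j.
    by move=> h; split=> // -[j ju]; apply: h; exists j.
  rewrite (_ : [set _ | _] = set0) //.
  by apply/seteqP; split => u //= -[k0' _]; rewrite k0' eqxx in k0.
apply/seteqP; split => u /=; last first.
  move=> [ku|[-> h]]; first exact: slot_sample.
  rewrite /sample; case: pickP => // j; rewrite inE => ju; exfalso.
  by apply: h; exists j.
rewrite /sample; case: pickP => [j|h] /=; first by rewrite inE => ? <-; left.
by move=> <-; right; split=> // -[j ju]; have := h j; rewrite mem_set.
Qed.

Context (mu0 : I -> R) (Q : I -> I -> R).
Hypothesis mu0_prob : prob_vector mu0.
Hypothesis Q_prob : forall j, prob_vector (Q j).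

Fixpoint chain n (w : R) : I * R :=
  if n is n'.+1 then step (Q (chain n' w).1) (chain n' w).2 else step mu0 w.

Lemma measurable_step mu k (B : set R) : prob_vector mu -> measurable B ->
  measurable [set u | (step mu u).1 = k /\ B (step mu u).2].
Proof.
move=> hmu mB; rewrite (_ : [set _ | _] =
  [set u | sample mu u = k] `&` (fun u => (u - cum mu k) / mu k) @^-1` B).
  apply: measurableI; first exact: measurable_sample.
  rewrite -[_ @^-1` _]setTI.
  suff mf : measurable_fun setT (fun u => (u - cum mu k) / mu k) by exact: mf.
  by apply: measurable_funM => //; apply: measurable_funB.
by apply/seteqP; split => u /= [<-].
Qed.

Lemma measurable_chain n k (B : set R) : measurable B ->
  measurable [set w | (chain n w).1 = k /\ B (chain n w).2].
Proof.
elim: n k B => [|n IH] k B mB; first exact: measurable_step.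
rewrite (_ : [set _ | _] = \bigcup_(j in setT)
  [set w | (chain n w).1 = j /\
     [set u | (step (Q j) u).1 = k /\ B (step (Q j) u).2] (chain n w).2]).
  apply: fin_bigcup_measurable => // j _; apply: IH; exact: measurable_step.
apply/seteqP; split => w /=; first by move=> h; exists (chain n w).1.
by move=> [j _ [<-]].
Qed.

Lemma measurable_chain_path (h : nat -> I) n :
  measurable [set w | forall i, (i <= n)%N -> (chain i w).1 = h i].
Proof.
rewrite (_ : [set _ | _] = \bigcap_(i in [set i | (i <= n)%N])
    [set w | (chain i w).1 = h i /\ setT (chain i w).2]).
  by apply: bigcap_measurableType => i _; exact: measurable_chain.
apply/seteqP; split => w hw i /= hi; first by split => //; exact: hw.
by case: (hw i hi).
Qed.

Lemma chain_unit n w : 0 <= w < 1 -> 0 <= (chain n w).2 < 1.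
Proof.
by move=> hw; elim: n => [|n IH] /=; apply: step_unit.
Qed.

Definition weight (h : nat -> I) n : R :=
  mu0 (h 0%N) * \prod_(i < n) Q (h i) (h i.+1).

(** Prescribing the path confines the driving point to a subinterval, of length
    [weight h n], which the running position parametrizes affinely. *)
Lemma chain_cylinder h n : exists c : R, forall x y, 0 <= x -> y <= 1 -> forall w,
  [/\ 0 <= w < 1, forall i, (i <= n)%N -> (chain i w).1 = h i
    & x <= (chain n w).2 < y] <->
  c + weight h n * x <= w < c + weight h n * y.
Proof.
elim: n => [|n [c IH]].
  exists (cum mu0 (h 0%N)) => x y x0 y1 w; rewrite /weight big_ord0 mulr1.
  rewrite -stepP //; split.
    by move=> [? h0 ?]; split => //; exact: (h0 0%N).
  by move=> [? h0 ?]; split => // -[|//].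
pose k := h n.+1; pose mu := Q (h n); have hmu : prob_vector mu by exact: Q_prob.
have [d0 _] := hmu.
have cle : cum mu k + mu k <= 1.
  by rewrite -cumS -(cum_top hmu); apply: le_cum.
have cge : 0 <= cum mu k by rewrite -(cum0 mu); apply: le_cum.
(* The longer cylinder starts where the slot of the new state starts within the
   shorter one. *)
exists (c + weight h n * cum mu k) => x y x0 y1 w.
have -> : weight h n.+1 = weight h n * mu k.
  by rewrite /weight big_ord_recr /= mulrA.
have dk := d0 k.
have x0' : 0 <= cum mu k + mu k * x by nra.
have y1' : cum mu k + mu k * y <= 1 by nra.
have IHw := IH _ _ x0' y1' w.
have E z : c + weight h n * cum mu k + weight h n * mu k * z =
  c + weight h n * (cum mu k + mu k * z) by ring.
rewrite !E.
apply: (iff_trans _ IHw); split.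
  move=> [w01 hi hx].
  have hn := hi n (leqnSn n); split => // [i ilen|]; first by apply: hi; exact: leqW.
  apply/(stepP _ _ hmu x0 y1); split; first exact: chain_unit.
  - by rewrite /mu -hn; exact: (hi n.+1).
  - by rewrite /mu -hn.
move=> [w01 hi /(stepP _ _ hmu x0 y1) [u01 s1 s2]].
have hn := hi n (leqnn n); split => //.
- move=> i; rewrite leq_eqVlt => /predU1P[->|]; last exact: hi.
  by rewrite /= hn.
- by rewrite /= hn.
Qed.

Local Notation U := (uniform_prob (@ltr01 R)).

Lemma uniform_prob_itvco x y : 0 <= x -> x <= y -> y <= 1 ->
  U `[x, y[%classic = (y - x)%:E.
Proof.
move=> x0 xy y1; rewrite /uniform_prob.
transitivity (\int[lebesgue_measure]_(u in `[x, y[%classic) (cst (1%:E : \bar R) u))%E.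
  apply: eq_integral => u; rewrite inE /= in_itv /= => /andP[h1 h2].
  by rewrite /uniform_pdf (le_trans x0 h1) (le_trans (ltW h2) y1) subr0 invr1.
rewrite integral_cst //= lebesgue_measure_itv /= lte_fin mul1e.
by move: xy; rewrite le_eqVlt => /predU1P[->|->//]; rewrite ltxx subrr.
Qed.

(** The cylinder is the subinterval of [chain_cylinder], up to points outside
    [0, 1), which are negligible. *)
Lemma chain_path_prob h n :
  U [set w | forall i, (i <= n)%N -> (chain i w).1 = h i] = (weight h n)%:E.
Proof.
set E := [set _ | _]; have mE : measurable E by exact: measurable_chain_path.
have mI : measurable (`[0, 1[%classic : set R) by exact: measurable_itv.
have -> : U E = U (E `&` `[0, 1[%classic).
  rewrite -[in LHS](setIT E) -(setUv `[0, 1[%classic) setIUr measureU //.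
  - rewrite [X in (_ + X)%E](_ : _ = 0%E) ?adde0 //.
    apply: (@subset_measure0 _ _ _ U _ (~` `[0, 1[%classic)) => //.
    + by apply: measurableI => //; exact: measurableC.
    + exact: measurableC.
    + apply: (etrans (@probability_setC _ _ _ U _ mI)).
      have /= -> := uniform_prob_itvco (lexx 0) ler01 (lexx 1).
      by rewrite subr0 subee.
  - exact: measurableI.
  - by apply: measurableI => //; exact: measurableC.
  - by rewrite setIACA setICr setI0.
have w0 : 0 <= weight h n.
  apply: mulr_ge0; first by case: mu0_prob.
  by apply: prodr_ge0 => i _; case: (Q_prob (h i)).
have [c hc] := chain_cylinder h n.
have EE : E `&` `[0, 1[%classic = `[c, (c + weight h n)[%classic.
  apply/seteqP; split => w /=; rewrite !in_itv /=.
    move=> [Ew w01]; have := (hc 0 1 _ _ w).1; rewrite mulr0 mulr1 addr0; apply => //.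
    by split => //; exact: chain_unit.
  move=> hw; have := (hc 0 1 _ _ w).2; rewrite mulr0 mulr1 addr0.
  by case=> // ? ?.
rewrite EE; have [<-|wn0] := eqVneq 0 (weight h n).
  by rewrite addr0 set_itvco0 measure0.
have wpos : 0 < weight h n by rewrite lt_neqAle wn0.
(* The nonempty half-open interval lies in [0, 1), which bounds its two ends. *)
have c0 : 0 <= c.
  have : (E `&` `[0, 1[%classic) c by rewrite EE /= in_itv /= lexx; lra.
  by move=> [_]; rewrite /= in_itv /= => /andP[].
have c1 : c + weight h n <= 1.
  rewrite leNgt; apply/negP => lt1.
  have : (E `&` `[0, 1[%classic) (Num.max c 1).
    by rewrite EE /= in_itv /= le_max lexx gt_max lt1 andbT ltrDl.
  by move=> [_]; rewrite /= in_itv /= gt_max ltxx !andbF.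
rewrite uniform_prob_itvco //; last by lra.
by rewrite addrAC subrr add0r.
Qed.
End Chain.

(** * The chain beside a given random time *)

Section ProductChain.
Context {R : realType} {m : nat} (s : m.+1.-tuple R).
Hypothesis hs : increasing s.
Context (mu0 : 'I_m.+1 -> R) (Q : 'M[R]_m.+1).
Hypothesis mu0_prob : prob_vector mu0.
Hypothesis Q_prob : forall j, prob_vector (Q j).
Context d0 (T0 : measurableType d0) (P0 : probability T0 R).

Local Notation U := (uniform_prob (@ltr01 R)).
Local Notation TT := (T0 * measurableTypeR R)%type.

Definition chain_prob : probability TT R := (P0 \x U)%E.

Definition chain_state n (w : TT) : 'I_m.+1 := (chain mu0 Q n w.2).1.

Definition chain_value n (w : TT) : R := s`_(chain_state n w).

Lemma chain_value_measurable n : measurable_fun setT (chain_value n).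
Proof.
move=> _ B mB; rewrite setTI (_ : _ @^-1` _ =
    \bigcup_(j in [set j : 'I_m.+1 | B s`_j])
      snd @^-1` [set u | (chain mu0 Q n u).1 = j /\ setT (chain mu0 Q n u).2]).
  apply: fin_bigcup_measurable => // j _; rewrite -[X in measurable X]setTI.
  by apply: measurable_snd => //; exact: measurable_chain.
apply/seteqP; split => w /=; first by move=> h; exists (chain_state n w).
by move=> [j Bj [/= h _]]; rewrite /chain_value /chain_state h.
Qed.

HB.instance Definition _ n :=
  isMeasurableFun.Build _ _ _ _ (chain_value n) (chain_value_measurable n).
HB.instance Definition _ :=
  isMeasurableFun.Build _ _ TT T0 fst measurable_fst.

Definition chain_process (n : nat) : {RV chain_prob >-> R} := [mfun of chain_value n].
Definition chain_proj : {mfun TT >-> T0} := [mfun of (fst : TT -> T0)].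

Lemma rectangleE (A : set T0) (B : set R) : measurable A ->
  measurable B -> chain_prob (A `*` B) = (P0 A * U B)%E.
Proof. by move=> mA mB; exact: (@product_measure1E _ _ _ _ R P0 U). Qed.

Lemma rectangle_l (A : set T0) : measurable A -> chain_prob (A `*` setT) = P0 A.
Proof.
move=> mA; apply: etrans (rectangleE mA measurableT) _.
by apply: etrans (mule1 _); congr (_ * _)%E; exact: probability_setT.
Qed.

Lemma rectangle_r (B : set R) : measurable B -> chain_prob (setT `*` B) = U B.
Proof.
move=> mB; apply: etrans (rectangleE measurableT mB) _.
by apply: etrans (mul1e _); congr (_ * _)%E; exact: probability_setT.
Qed.

Lemma chain_path_event h n : path_event s chain_process h n =
  setT `*` [set u | forall i, (i <= n)%N -> (chain mu0 Q i u).1 = h i].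
Proof.
apply/seteqP; split => w.
  by move=> hw; split => // i hi; apply: (nth_inj hs); exact: hw.
by move=> [_ hw] i hi; rewrite /= /chain_value /chain_state (hw i hi).
Qed.

Lemma chain_path_event_prob h n :
  chain_prob (path_event s chain_process h n) = (weight mu0 Q h n)%:E.
Proof.
rewrite chain_path_event rectangle_r; first exact: chain_path_prob.
exact: measurable_chain_path.
Qed.

Lemma chain_process_state n w : chain_process n w \in (s : seq R).
Proof. by rewrite mem_nth // size_tuple. Qed.

Lemma chain_markov : time_homogeneous_markov s Q chain_process.
Proof.
move=> n h k Eh0.
pose h' i := if (i <= n)%N then h i else k.
have E' : chain_process n.+1 @^-1` [set s`_k] `&` path_event s chain_process h n =
    path_event s chain_process h' n.+1.
  apply/seteqP; split => w.
    move=> [hk hw] i; rewrite leq_eqVlt /h' => /predU1P[->|].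
      by rewrite ltnn.
    by rewrite ltnS => iln; rewrite iln; exact: hw.
  move=> hw; split; first by have := hw n.+1 (leqnn _); rewrite /h' ltnn.
  by move=> i iln; rewrite hw ?leqW // /h' iln.
have wS : weight mu0 Q h' n.+1 = weight mu0 Q h n * Q (h n) k.
  rewrite /weight big_ord_recr /= mulrA /h' /= leqnn ltnn; congr (_ * _ * _).
  by apply: eq_bigr => i _; rewrite ltn_ord (ltnW (ltn_ord i)).
move: Eh0; rewrite /cprob E' !chain_path_event_prob wS /= => w0.
by rewrite mulrAC divff ?mul1r.
Qed.

Lemma chain_start (k : 'I_m.+1) :
  chain_prob (chain_process 0 @^-1` [set s`_k]) = (mu0 k)%:E.
Proof.
rewrite -[mu0 k]mulr1.
rewrite (_ : _ @^-1` _ = path_event s chain_process (fun=> k) 0).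
  by rewrite chain_path_event_prob /weight big_ord0.
by apply/seteqP; split => w hw; [case|exact: (hw 0%N)].
Qed.

Lemma chain_proj_extension (A : set T0) : measurable A ->
  chain_prob (chain_proj @^-1` A) = P0 A.
Proof.
move=> mA; rewrite (_ : _ @^-1` _ = A `*` setT).
  exact: rectangle_l.
by apply/seteqP; split => w //= [].
Qed.

(** The process reads the second coordinate and the time reads the first. *)
Lemma chain_indep (tau : {RV P0 >-> nat}) :
  indep_process_time chain_prob chain_process (tau \o chain_proj).
Proof.
move=> A B hA.
suff [C mC <-] : preimage_set_system setT (snd : TT -> measurableTypeR R) measurable A.
  have mB : measurable (tau @^-1` B) by apply: measurable_funPTI.
  rewrite setTI (_ : snd @^-1` C = setT `*` C); last first.
    by apply/seteqP; split => w //= [].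
  rewrite (_ : _ @^-1` B = (tau @^-1` B) `*` setT); last first.
    by apply/seteqP; split => w //= [].
  rewrite -setXI setTI setIT rectangleE // muleC.
  by rewrite rectangle_r // rectangle_l.
move: A hA; suff : sigma_proc chain_process setT `<=`
  preimage_set_system setT (snd : TT -> measurableTypeR R) measurable by [].
apply: smallest_sub.
  by apply: sigma_algebra_preimage; exact: sigma_algebra_measurable.
move=> C [n _ [D mD <-]].
exists [set u | D s`_(chain mu0 Q n u).1]; last by [].
rewrite (_ : [set _ | _] = \bigcup_(j in [set j : 'I_m.+1 | D s`_j])
    [set u | (chain mu0 Q n u).1 = j /\ setT (chain mu0 Q n u).2]).
  by apply: fin_bigcup_measurable => // j _; exact: measurable_chain.
apply/seteqP; split => w /=; first by move=> h; exists (chain mu0 Q n w).1.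
by move=> [j Dj [/= -> _]].
Qed.

End ProductChain.

(** * Existence and uniqueness of the solution *)

Section Solutions.
Context (R : realType) (M : nat) (s p : M.-tuple R).
Hypothesis hs : increasing s.
Hypothesis hp : forall j : 'I_M, 0 < p`_j.
Context (l : nat) (hl : (0 < l < M)%N) (a : R) (ha : 0 < a < 1).
Context (d0 : measure_display) (T0 : measurableType d0) (P0 : probability T0 R).
Context (tau : {RV P0 >-> nat}).
Hypothesis htau : forall k : nat,
  P0 (tau @^-1` [set k]) = ((1 - a) * a ^+ k)%:E.

Lemma measurable_time d (T : measurableType d) (pi : {mfun T >-> T0}) n :
  measurable ((tau \o pi) @^-1` [set n]).
Proof.
rewrite comp_preimage; apply: measurable_funPTI; exact: measurable_funPTI.
Qed.

Lemma solution_balance d (T : measurableType d) (P : probability T R)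
    (pi : {mfun T >-> T0}) (q : M.-tuple R) (X : nat -> {RV P >-> R}) :
  dmrw_solution s p l tau pi q X -> balance s p l q a.
Proof.
move=> [hext [_ Xs _ hX] hind [hs1 hs2] hlaw] k.
have hsig n : P ((tau \o pi) @^-1` [set n]) = ((1 - a) * a ^+ n)%:E.
  by rewrite comp_preimage hext ?htau //; exact: measurable_funPTI.
have := law_balance hs Xs hX (measurable_time pi) hsig hind p k hl hs1 hs2.
move=> /= E; rewrite -{1}(hlaw k) E; congr (_ + _ * _).
by apply: eq_bigr => j _; rewrite -(hlaw j).
Qed.

Lemma solution_param d (T : measurableType d) (P : probability T R)
    (pi : {mfun T >-> T0}) (q : M.-tuple R) (X : nat -> {RV P >-> R}) :
  dmrw_solution s p l tau pi q X ->
  dmrw_param q /\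
  forall j : nat, (0 < j < M.-1)%N -> q`_j = (a^-1 - 1) * calF s p l j.
Proof.
move=> sol; have hq : dmrw_param q by case: (sol_dmrw sol).
split=> //.
exact: (balance_param hs hp hl ha hq (solution_balance sol)).
Qed.

End Solutions.

(** The chain started from either of the two relevant states with probability one
    half solves the problem: the law that it produces and [p] both satisfy
    [balance], which has one solution. *)
Lemma param_solution (R : realType) (m : nat) (s p q : m.+1.-tuple R)
    (hs : increasing s)
    (hp1 : \sum_(j < m.+1) p`_j = 1)
    (l : nat) (hl : (0 < l < m.+1)%N) (a : R) (ha : 0 < a < 1)
    (d0 : measure_display) (T0 : measurableType d0) (P0 : probability T0 R)
    (tau : {RV P0 >-> nat})
    (htau : forall k : nat,
      P0 (tau @^-1` [set k]) = ((1 - a) * a ^+ k)%:E) :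
  dmrw_param q -> balance s p l q a ->
  exists (d : measure_display) (T : measurableType d) (P : probability T R)
      (pi : {mfun T >-> T0}) (X : nat -> {RV P >-> R}),
      dmrw_solution s p l tau pi q X.
Proof.
move=> hq hb.
(* Both states have to be charged for the conditioning, whereas the two-point law
   charges only one of them if [mean s p] is [s`_l]. *)
pose mu0 (k : 'I_m.+1) : R := 2^-1 * (k == l :> nat)%:R + 2^-1 * (k == l.-1 :> nat)%:R.
have lM : (l < m.+1)%N by lia.
have lM1 : (l.-1 < m.+1)%N by lia.
have mu0_prob : prob_vector mu0.
  split => [k|]; first by rewrite /mu0 addr_ge0 // mulr_ge0 // invr_ge0.
  under eq_bigr do rewrite /mu0 -mulrDr.
  rewrite -mulr_sumr big_split /=.
  have h (j : nat) : (j < m.+1)%N -> \sum_(k < m.+1) (k == j :> nat)%:R = 1 :> R.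
    move=> jM; rewrite -[RHS](sum_indic (fun=> 1) jM).
    by apply: eq_bigr => k _; rewrite mulr1.
  by rewrite !h // mulVf.
have Q_prob j : prob_vector (dmrw_tmx s q j).
  split => [k|]; first exact: tmx_ge0.
  have := sum_tmx hs j 1 0 hq; rewrite mul0r addr0 => <-.
  by apply: eq_bigr => k _; rewrite mul0r addr0 mulr1.
pose X := chain_process s mu0_prob Q_prob P0.
have hX : time_homogeneous_markov s (dmrw_tmx s q) X by exact: chain_markov.
have Xs : forall n w, X n w \in (s : seq R) by exact: chain_process_state.
have hext : forall A, measurable A -> chain_prob P0 (chain_proj T0 @^-1` A) = P0 A.
  by move=> A; exact: chain_proj_extension.
have hind : indep_process_time (chain_prob P0) X (tau \o chain_proj (R := R) T0).
  exact: chain_indep.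
have hs1 : chain_prob P0 (X 0%N @^-1` [set s`_l]) != 0%E.
  rewrite (chain_start hs mu0_prob Q_prob P0 (Ordinal lM)) /mu0 /= eqxx.
  by rewrite eqe; apply: lt0r_neq0; rewrite mulr1 ltr_pwDl // ?invr_gt0 // mulr_ge0.
have hs2 : chain_prob P0 (X 0%N @^-1` [set s`_l.-1]) != 0%E.
  rewrite (chain_start hs mu0_prob Q_prob P0 (Ordinal lM1)) /mu0 /= eqxx.
  by rewrite eqe; apply: lt0r_neq0; rewrite mulr1 ltr_wpDl // ?invr_gt0 // mulr_ge0.
exists _, _, (chain_prob P0), (chain_proj T0), X; split => //.
  split => //; apply: (markov_martingale hs Xs hX) => j.
  have := sum_tmx hs j 0 1 hq; rewrite mul1r add0r => <-.
  by apply: eq_bigr => k _; rewrite mul1r add0r.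
have hsig n : chain_prob P0 ((tau \o chain_proj T0) @^-1` [set n]) = ((1 - a) * a ^+ n)%:E.
  by rewrite comp_preimage hext ?htau //; exact: measurable_funPTI.
have mt := measurable_time tau (chain_proj (R := R) T0).
have hv k := law_balance hs Xs hX mt hsig hind p k hl hs1 hs2.
move=> j /=; apply/eqP; rewrite -subr_eq0; apply/eqP.
move: j; apply: (discounted_fixpoint_eq0 (a := a) (Q := dmrw_tmx s q)).
- by case/andP: ha => h1 h2; rewrite (ltW h1).
- by move=> j k; exact: tmx_ge0.
- by move=> j; case: (Q_prob j).
move=> k; rewrite /= in hv; rewrite hv {1}hb.
under [in RHS]eq_bigr do rewrite mulrBl.
by rewrite sumrB mulrBr; ring.
Qed.

Theorem theorem2p5 (R : realType) (M : nat) (hM : (2 <= M)%N)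
    (s p : M.-tuple R)
    (hs : forall j k : 'I_M, (j < k)%N -> s`_j < s`_k)
    (hp : forall j : 'I_M, 0 < p`_j)
    (hp1 : \sum_(j < M) p`_j = 1)
    (l : nat) (hl : (0 < l < M)%N) (hel : s`_l.-1 < mean s p <= s`_l)
    (a : R) (ha : 0 < a < 1)
    (d0 : measure_display) (T0 : measurableType d0) (P0 : probability T0 R)
    (tau : {RV P0 >-> nat})
    (htau : forall k : nat,
      P0 (tau @^-1` [set k]) = ((1 - a) * a ^+ k)%:E) :
  ((exists (d : measure_display) (T : measurableType d) (P : probability T R)
      (pi : {mfun T >-> T0}) (q : M.-tuple R) (X : nat -> {RV P >-> R}),
      dmrw_solution s p l tau pi q X)
   <->
   \big[Num.max/(a^-1 - 1) * calF s p l 0]_(k < M)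
      ((a^-1 - 1) * calF s p l k) <= 1)
  /\
  (forall (d : measure_display) (T : measurableType d) (P : probability T R)
      (pi : {mfun T >-> T0}) (q : M.-tuple R) (X : nat -> {RV P >-> R}),
      dmrw_solution s p l tau pi q X ->
      [/\ q`_0 = 0, q`_M.-1 = 0 &
          forall j : nat, (0 < j < M.-1)%N ->
            q`_j = (a^-1 - 1) * calF s p l j]).
Proof.
have F0 k : ~~ (0 < k < M.-1)%N -> calF s p l k = 0.
  by move=> /negPf kout; rewrite /calF /calL kout ltxx.
have c0 : 0 <= a^-1 - 1.
  by case/andP: ha => a0 a1; rewrite subr_ge0 invf_ge1 // ltW.
split; last first.
  by move=> d T P pi q X /(solution_param hs hp hl ha htau) [[q0 qM _] qE].
split.
  move=> [d [T [P [pi [q [X]]]]]] /(solution_param hs hp hl ha htau).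
  move=> [[_ _ q01] qE]; apply/bigmax_leP; split.
    by rewrite F0 ?mulr0 //; lia.
  move=> k _; have [kin|kout] := boolP (0 < k < M.-1)%N; last by rewrite F0 // mulr0.
  by rewrite -qE //; case/andP: (q01 k).
move=> /bigmax_leP [_ Fle].
case: M hM s p hs hp hp1 hl hel F0 Fle => [//|m] hM s p hs hp hp1 hl hel F0 Fle.
pose q : m.+1.-tuple R := [tuple (a^-1 - 1) * calF s p l k | k < m.+1].
have qE k : (k < m.+1)%N -> q`_k = (a^-1 - 1) * calF s p l k.
  pose F (k : 'I_m.+1) := (a^-1 - 1) * calF s p l k.
  by move=> km; exact: (nth_mktuple F 0 (Ordinal km)).
have hq : dmrw_param q.
  split.
  - by rewrite qE // F0 ?mulr0.
  - by rewrite qE // F0 ?mulr0 // ltnn andbF.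
  - move=> j; rewrite qE // Fle // andbT mulr_ge0 //.
    by rewrite /calF; case: ifP => // h; rewrite divr_ge0 ?ltW.
have hb : balance s p l q a.
  by apply: param_balance => // i hi; apply: qE; lia.
have [d [T [P [pi [X sol]]]]] := param_solution hs hp1 hl ha htau hq hb.
by exists d, T, P, pi, q, X.
Qed.
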